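(* Let $b,n$ be positive integers with $b+1\leq n$. Then: \begin{itemize} \item if $n\geq 3b+2$, then $p_{b+1,n}>p_{b,n}$; \item if $n\leq 3b+1$, then $p_{b+1,n}<p_{b,n}$. \end{itemize}
   Context: For positive integers $b\leq n$, let $\xi_{b,n}$ be a binomial random variable with parameters $n$ and $b/n$ (number of trials $n$, success probability $b/n$), and let $p_{b,n}:={\sf P}(\xi_{b,n}<b)=\sum_{i=0}^{b-1}\binom{n}{i}(b/n)^i(1-b/n)^{n-i}$. *)

(* Defs.v *)
From mathcomp Require Import all_boot all_order all_algebra.
From mathcomp Require Import all_classical all_reals all_analysis.

Set Implicit Arguments.
Unset Strict Implicit.
Unset Printing Implicit Defensive.

Import Order.TTheory GRing.Theory Num.Theory.

Local Open Scope classical_set_scope.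
Local Open Scope ring_scope.

(* P(xi < b) for xi binomial with n trials and success probability b/n.
   [binomial_prob n q] is the binomial law only when 0 <= q <= 1 (it is a Dirac
   mass at 0 otherwise), so this is meaningful for 0 < b <= n. *)
Definition binom_below_mean (R : realType) (b n : nat) : R :=
  fine (binomial_prob n (b%:R / n%:R : R) [set k | (k < b)%N]).

Lemma mean_ratio01 (R : realType) (b n : nat) :
  (b <= n)%N -> 0 <= (b%:R / n%:R : R) <= 1.
Proof.
case: n => [|n] bn; first by rewrite invr0 mulr0 lexx ler01.
by rewrite divr_ge0 ?ler0n//= ler_pdivrMr ?ltr0n// mul1r ler_nat.
Qed.

Lemma binom_below_meanE (R : realType) (b n : nat) : (b <= n)%N ->
  binom_below_mean R b n =
  \sum_(0 <= i < b)
    'C(n, i)%:R * (b%:R / n%:R) ^+ i * (1 - b%:R / n%:R) ^+ (n - i).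
Proof.
move=> bn; have q01 := mean_ratio01 R bn.
rewrite /binom_below_mean /binomial_prob q01 esum_fset//=; last first.
  by move=> i _; rewrite lee_fin binomial_pmf_ge0.
rewrite -fsbig_ord sumEFin/= big_mkord; apply: eq_bigr => i _.
by rewrite -[RHS]mulrA [RHS]mulr_natl.
Qed.

Lemma binom_below_mean_rv (R : realType) (d : measure_display)
    (T : measurableType d) (P : probability T R) (b n : nat)
    (xi : {RV P >-> nat}) :
  distribution P xi = binomial_prob n (b%:R / n%:R) :> (set nat -> \bar R) ->
  fine (P [set t | (xi t < b)%N]) = binom_below_mean R b n.
Proof. by move=> xiE; rewrite /binom_below_mean -xiE. Qed.

(* Main.v *)
Require Import Defs.
From mathcomp Require Import all_boot all_order all_algebra.
From mathcomp Require Import all_classical all_reals all_analysis.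
From mathcomp Require Import polyrcf ring lra zify.

(** The derivative of P(Bin(n, q) <= b) in q is
    - (n - b) C(n, b) q^b (1-q)^(n-b-1).
    Integrating it from q = b/n to q = (b+1)/n and writing c = n - b gives
      p_{b+1,n} - p_{b,n} = K (1 - int_0^1 h_c(s) ds),
      K = P(xi_{b,n} = b),  h_c(s) = (1 + s/b)^b (1 - s/c)^(c-1).
    By Bernoulli's inequality h_c is nonincreasing in c, so it is enough to
    treat c = 2b+1 and c = 2b+2.  There (1 + s/b)(1 - s/c)^2 is 1 + O(1/b^2), and
    elementary bounds on its b-th power yield polynomials in s of degree at most 4
    below (resp. above) h_c, whose integrals are 1 + 1/(12 (2b+1)^2) and, with
    d = b+1, 1 - (7d - 5)/(800 d^3). *)

Set Implicit Arguments.
Unset Strict Implicit.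
Unset Printing Implicit Defensive.

Import Order.TTheory GRing.Theory Num.Theory.

Local Open Scope ring_scope.

(** * Bernoulli's inequality and derivatives of polynomials *)

Lemma bernoulli_ler (R : realDomainType) (x : R) n :
  -1 <= x -> 1 + n%:R * x <= (1 + x) ^+ n.
Proof.
move=> x_ge; have x1 : 0 <= 1 + x by lra.
elim: n => [|n IHn]; first by rewrite mul0r addr0.
rewrite exprS; apply: le_trans (ler_wpM2l x1 IHn).
have : 0 <= n%:R * x ^+ 2 by rewrite mulr_ge0 ?ler0n ?sqr_ge0.
rewrite -natr1; nra.
Qed.

(** With [A] as success and [B] as failure probability, this differentiates the binomial
    distribution function. The sum telescopes: differentiating the power of [A] in a new term
    cancels what the earlier terms left. *)
Lemma deriv_binom_head (R : comNzRingType) (A B : {poly R}) n k :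
  B^`() = - A^`() ->
  (\sum_(i < k.+1) (A ^+ i * B ^+ (n - i)) *+ 'C(n, i))^`() =
  - (A^`() * A ^+ k * B ^+ (n - k.+1)) *+ ((n - k) * 'C(n, k)).
Proof.
move=> dB; elim: k => [|k IHk].
  rewrite big_ord1 bin0 !mul1r mulr1n !subn0 deriv_exp dB mulNr mulNrn.
  by rewrite muln1 subn1 mulr1 mulNrn.
rewrite big_ord_recr derivD IHk -mul_bin_left /=.
rewrite derivMn derivM !deriv_exp dB -subnS.
rewrite mulrnAl mulrnDl -mulrnA mulNrn addKr mulrnAr -mulrnA.
by congr (_ *+ _); rewrite exprS; ring.
Qed.

(** Stands in for monotonicity of the integral; it is the mean value theorem for [q - p]. *)
Lemma le_horner_increment (R : rcfType) (p q : {poly R}) (a b : R) : a < b ->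
  (forall x, a <= x <= b -> p^`().[x] <= q^`().[x]) ->
  p.[b] - p.[a] <= q.[b] - q.[a].
Proof.
move=> ab dpq; have [x] := poly_mvt (q - p) ab.
rewrite in_itv/= => /andP[/ltW ax /ltW xb] E.
have : 0 <= (q - p)^`().[x] * (b - a).
  rewrite mulr_ge0 ?subr_ge0 ?(ltW ab)//.
  by rewrite derivB !hornerE subr_ge0 dpq ?ax.
rewrite -E !hornerE; lra.
Qed.

(** * Bounds on the integrand *)

(* The function [h_c] of the header, with [c = m.+1]. *)
Definition density_ratio (R : realFieldType) (b m : nat) (s : R) : R :=
  (1 + s / b%:R) ^+ b * (1 - s / m.+1%:R) ^+ m.

(** The base at m is the base [d] at m+1 times 1 - s/((m+1)(m+2-s)). By Bernoulli's inequality the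
    m-th power of this quotient is at least [d]. *)
Lemma one_sub_div_exp_anti (R : realFieldType) (s : R) :
  0 <= s <= 1 ->
  {homo (fun m => (1 - s / m.+1%:R) ^+ m) : m k / (m <= k)%N >-> k <= m}.
Proof.
move=> /andP[s0 s1]; apply: homo_leq => [//|x y z xy yz|m].
  exact: le_trans yz xy.
set M : R := m%:R; have M0 : 0 <= M by exact: ler0n.
have -> : m.+2%:R = M + 2 :> R by rewrite -addn2 natrD.
rewrite -[m.+1%:R]natr1 -/M.
set d := 1 - s / (M + 2).
have d0 : 0 < d by rewrite /d subr_gt0 ltr_pdivrMr; lra.
have aE : 1 - s / (M + 1) = d * (1 + (- s / ((M + 1) * (M + 2 - s)))).
  by rewrite /d; field; apply/andP; split; lra.
rewrite aE exprMn exprSr ler_pM2l ?exprn_gt0//.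
apply: le_trans (bernoulli_ler _ _); last first.
  rewrite mulNr lerN2 ler_pdivrMr ?mulr_gt0; nra.
rewrite -/M -subr_ge0 /d.
have -> : 1 + M * (- s / ((M + 1) * (M + 2 - s))) - (1 - s / (M + 2)) =
  s * (M + 2 - s * (M + 1)) / ((M + 1) * (M + 2 - s) * (M + 2)).
  by field; repeat (apply/andP; split); lra.
by rewrite divr_ge0 ?mulr_ge0//; nra.
Qed.

Lemma density_ratio_anti (R : realFieldType) (b : nat) (s : R) : 0 <= s <= 1 ->
  {homo (fun m => density_ratio b m s) : m k / (m <= k)%N >-> k <= m}.
Proof.
move=> s01 m k mk; rewrite ler_wpM2l ?(one_sub_div_exp_anti s01)//.
by rewrite exprn_ge0// addr_ge0 ?divr_ge0 ?ler0n//; case/andP: s01.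
Qed.

(** Each 1 + s/b pairs with two factors of the even power: (1 + s/b)(1 - s/(2b+1))^2 is exactly 1 +
    y/b, where 1 + y is the claimed bound. Bernoulli's inequality concludes. *)
Lemma density_ratio_lower (R : realFieldType) (b : nat) (s : R) : (0 < b)%N ->
  0 <= s <= 1 ->
  1 + ((2 * b%:R + 1) * s - (3 * b%:R + 2) * s ^+ 2 + s ^+ 3)
      / (2 * b%:R + 1) ^+ 2 <= density_ratio b (2 * b) s.
Proof.
move=> b0 /andP[s0 s1]; rewrite /density_ratio exprM -exprMn.
have -> : (2 * b).+1%:R = 2 * b%:R + 1 :> R by rewrite -natr1 natrM.
have : 1 <= b%:R :> R by rewrite ler1n.
set B : R := b%:R => B1.
set y := ((2 * B + 1) * s - (3 * B + 2) * s ^+ 2 + s ^+ 3)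
      / (2 * B + 1) ^+ 2.
have -> : (1 + s / B) * (1 - s / (2 * B + 1)) ^+ 2 = 1 + y / B.
  by rewrite /y; field; apply/andP; split; lra.
apply: le_trans (bernoulli_ler _ _); last first.
  rewrite /y -mulrA -invfM lerNl -mulNr ler_pdivrMr; last first.
    by rewrite mulr_gt0 ?exprn_gt0//; lra.
  have s2 : s ^+ 2 <= 1 by rewrite exprn_ile1.
  have : 0 <= B * (1 - s ^+ 2) by rewrite mulr_ge0 ?subr_ge0//; lra.
  have : 0 <= s ^+ 3 by rewrite exprn_ge0.
  have : 9 * B <= (2 * B + 1) ^+ 2 * B by rewrite ler_wpM2r; nra.
  have : 0 <= B * s by rewrite mulr_ge0; lra.
  move: (s ^+ 2) (s ^+ 3) s2 (_ ^+ 2 * B) => u v u1 D; nra.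
by rewrite mulrCA divff ?mulr1// gt_eqF//; lra.
Qed.

Lemma one_add_div_exp_upper (R : realFieldType) (b : nat) (x : R) :
  (0 < b)%N -> 0 <= x -> x <= 1 / 6 ->
  (1 + x / b%:R) ^+ b <= 1 + x + 6 / 5 * x ^+ 2.
Proof.
move=> b0 x0 x6; have B1 : 1 <= b%:R :> R by rewrite ler1n.
have y0 : 0 <= x / b%:R by rewrite divr_ge0//; lra.
have y6 : x / b%:R <= 1 / 6 by rewrite ler_pdivrMr; nra.
(* [(1 + x/b)^b <= 1/(1-x)], because [1 - x <= (1 - x/b)^b] *)
have le1 : (1 + x / b%:R) ^+ b * (1 - x) <= 1.
  apply: (@le_trans _ _ ((1 + x / b%:R) ^+ b * (1 - x / b%:R) ^+ b)).
    rewrite ler_wpM2l ?exprn_ge0//; first lra.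
    apply: le_trans (bernoulli_ler _ _); last lra.
    by rewrite mulrN mulrCA divff ?mulr1// gt_eqF ?ltr0n.
  by rewrite -exprMn exprn_ile1//; nra.
(* 1/(1-x) = 1 + x + x^2/(1-x), and 1/(1-x) <= 6/5 when x <= 1/6. *)
have : (1 + x / b%:R) ^+ b * (1 - x) <= (1 + x + 6 / 5 * x ^+ 2) * (1 - x).
  by apply: le_trans le1 _; nra.
by rewrite ler_pM2r; lra.
Qed.

(** Here [c] is the d of the header. The exponent 2b+1 is odd, so pairing as in the lower bound
    gives (1 + x/b)^b and leaves one factor 1 - s/(2c). *)
Lemma density_ratio_upper (R : realFieldType) (b : nat) (s c x : R) :
  (0 < b)%N ->
  0 <= s <= 1 ->
  c = b%:R + 1 ->
  x = (4 * c * s - (3 * c + 1) * s ^+ 2 + s ^+ 3) / (4 * c ^+ 2) ->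
  density_ratio b (2 * b).+1 s <=
    1 + x - s / (2 * c) - x * s / (2 * c)
    + 3 / 40 * (4 * s - 3 * s ^+ 2) ^+ 2 / c ^+ 2.
Proof.
move=> b0 /andP[s0 s1] cE xE.
have B1 : 1 <= b%:R :> R by rewrite ler1n.
have bE : b%:R = c - 1 by rewrite cE addrK.
have c2 : 2 <= c by lra.
rewrite /density_ratio exprSr exprM mulrA -exprMn.
have -> : (2 * b).+2%:R = 2 * c :> R by rewrite cE -addn2 natrD natrM; ring.
have -> : (1 + s / b%:R) * (1 - s / (2 * c)) ^+ 2 = 1 + x / b%:R.
  by rewrite bE xE; field; apply/andP; split; lra.
(* The leading part of [x] in 1/c. Using it in the quadratic term keeps the bound of degree 4 in
   [s]. *)
set z := s * (4 - 3 * s) / (4 * c).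
have x0 : 0 <= x.
  have -> : x = s * (4 * c * (1 - s) + (c - 1) * s + s ^+ 2) / (4 * c ^+ 2).
    by rewrite xE; field; lra.
  rewrite divr_ge0 ?mulr_ge0 ?exprn_ge0 ?addr_ge0 ?mulr_ge0 ?exprn_ge0//; lra.
have xz : x <= z.
  rewrite -subr_ge0; have -> : z - x = s ^+ 2 * (1 - s) / (4 * c ^+ 2).
    by rewrite /z xE; field; lra.
  by rewrite divr_ge0 ?mulr_ge0 ?exprn_ge0//; lra.
(* s(4-3s) is at most 4/3, attained at s = 2/3, and c >= 2. *)
have z6 : z <= 1 / 6.
  rewrite ler_pdivrMr; last lra.
  have := sqr_ge0 (3 * s - 2); nra.
have t0 : 0 <= s / (2 * c) by rewrite divr_ge0//; lra.
have t1 : s / (2 * c) <= 1 by rewrite ler_pdivrMr; lra.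
have := one_add_div_exp_upper b0 x0 (le_trans xz z6).
move: ((1 + x / b%:R) ^+ b) => u uP.
have -> : 3 / 40 * (4 * s - 3 * s ^+ 2) ^+ 2 / c ^+ 2 = 6 / 5 * z ^+ 2.
  by rewrite /z; field; lra.
rewrite -mulrA; move: (s / (2 * c)) t0 t1 => t t0 t1.
have xz2 : x ^+ 2 <= z ^+ 2 by rewrite ler_sqr ?nnegrE//; lra.
have : u * (1 - t) <= (1 + x + 6 / 5 * x ^+ 2) * (1 - t).
  by rewrite ler_wpM2r//; lra.
have : 0 <= x ^+ 2 * t by rewrite mulr_ge0 ?exprn_ge0//; lra.
nra.
Qed.

(** * Integration over [0, 1] and the step from b to b+1 *)

Lemma horner_increment_le_quartic (R : rcfType) (q : {poly R})
    (a0 a1 a2 a3 a4 : R) :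
  (forall s, 0 <= s <= 1 ->
     q^`().[s] <= a0 + a1 * s + a2 * s ^+ 2 + a3 * s ^+ 3 + a4 * s ^+ 4) ->
  q.[1] - q.[0] <= a0 + a1 / 2 + a2 / 3 + a3 / 4 + a4 / 5.
Proof.
move=> dq.
pose w : {poly R} := a0 *: 'X + (a1 / 2) *: 'X^2 + (a2 / 3) *: 'X^3
  + (a3 / 4) *: 'X^4 + (a4 / 5) *: 'X^5.
have -> : a0 + a1 / 2 + a2 / 3 + a3 / 4 + a4 / 5 = w.[1] - w.[0].
  by rewrite /w !hornerE /=; ring.
apply: le_horner_increment => [|s /dq/le_trans->//]; first exact: ltr01.
rewrite /w !poly.derivE !hornerE /= le_eqVlt; apply/orP; left; apply/eqP.
by field.
Qed.

Lemma binom_below_mean_step (R : realType) (b n : nat) :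
  (0 < b)%N -> (b < n)%N ->
  exists K : R, exists q : {poly R}, [/\ 0 < K,
    binom_below_mean R (b + 1) n - binom_below_mean R b n =
      K * (1 + (q.[1] - q.[0])) &
    forall s, q^`().[s] = - density_ratio b (n - b).-1 s].
Proof.
move=> b0 bn; have n0 : n%:R != 0 :> R by rewrite pnatr_eq0; lia.
have br : b%:R != 0 :> R by rewrite pnatr_eq0; lia.
have cr : (n - b)%:R != 0 :> R by rewrite pnatr_eq0; lia.
(* The success probability is (b+s)/n, so [F.[s]] is the probability of at most b successes. *)
pose A : {poly R} := (b%:R / n%:R)%:P + n%:R^-1 *: 'X.
pose B : {poly R} := (1 - b%:R / n%:R)%:P - n%:R^-1 *: 'X.
pose F := \sum_(i < b.+1) (A ^+ i * B ^+ (n - i)) *+ 'C(n, i).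
pose K : R := 'C(n, b)%:R * (b%:R / n%:R) ^+ b * (1 - b%:R / n%:R) ^+ (n - b).
have K0 : 0 < K.
  rewrite !mulr_gt0 ?exprn_gt0 ?ltr0n ?bin_gt0 ?divr_gt0 ?ltr0n ?subr_gt0//;
    try lia.
  by rewrite ltr_pdivrMr ?ltr0n ?mul1r ?ltr_nat//; lia.
have FE s : F.[s] = \sum_(i < b.+1)
    'C(n, i)%:R * (b%:R / n%:R + n%:R^-1 * s) ^+ i *
    (1 - b%:R / n%:R - n%:R^-1 * s) ^+ (n - i).
  rewrite horner_sum; apply: eq_bigr => i _.
by rewrite hornerMn hornerM !horner_exp /A /B !hornerE -mulr_natl mulrA.
(* The sum in [F] includes i = b: at s = 0 this is the extra term [K], while at s = 1 it belongs to
   the strict tail below b+1. *)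
have F0 : F.[0] = binom_below_mean R b n + K.
  rewrite FE binom_below_meanE; last lia.
  rewrite big_ord_recr big_mkord /= !mulr0 !addr0 !subr0.
  by congr (_ + _); apply: eq_bigr => i _; rewrite !mulr0 addr0 subr0.
have F1 : F.[1] = binom_below_mean R (b + 1) n.
  rewrite FE binom_below_meanE; last lia.
  rewrite big_mkord addn1 -natr1; apply: eq_bigr => i _.
  by congr (_ * _ ^+ _ * _ ^+ _); field.
exists K, (K^-1 *: F); split=> // [|s].
  by rewrite !hornerE F0 F1 /=; field; exact: lt0r_neq0.
have dA : A^`() = (n%:R^-1)%:P by rewrite /A !poly.derivE add0r ?alg_polyC.
have dB : B^`() = - A^`() by rewrite dA /B !poly.derivE sub0r ?alg_polyC.
rewrite derivZ (deriv_binom_head _ _ dB) dA hornerZ hornerMn hornerN !hornerM.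
rewrite !horner_exp /A /B !hornerE /density_ratio /=.
have [m mE] : exists m, (n - b)%N = m.+1 by exists (n - b).-1; lia.
have nE : n%:R = b%:R + m.+1%:R :> R by rewrite -mE -natrD (subnKC (ltnW bn)).
have qE : 1 - b%:R / n%:R = m.+1%:R / n%:R :> R.
  by apply: (mulIf n0); rewrite mulrBl mul1r !mulfVK// nE addrC addKr.
rewrite /K qE subnS mE /= in cr *.
have -> : b%:R / n%:R + n%:R^-1 * s = b%:R / n%:R * (1 + s / b%:R).
  by field; rewrite br n0.
have -> : m.+1%:R / n%:R - n%:R^-1 * s = m.+1%:R / n%:R * (1 - s / m.+1%:R).
  move: (m.+1%:R : R) cr => c cr.
  by field; rewrite cr n0.
have C0 : 'C(n, b)%:R != 0 :> R by rewrite pnatr_eq0 -lt0n bin_gt0 ltnW.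
set x := b%:R / n%:R; set y := m.+1%:R / n%:R.
have X0 : x ^+ b != 0 by rewrite expf_neq0// mulf_neq0 ?invr_eq0.
have Y0 : y ^+ m != 0 by rewrite expf_neq0// mulf_neq0 ?invr_eq0.
rewrite [(x * _) ^+ _]exprMn [(y * _) ^+ _]exprMn exprSr -[_ *+ (_ * _)]mulr_natr natrM.
move: (x ^+ b) (y ^+ m) X0 Y0 => X Y X0 Y0.
move: ((1 + _) ^+ b) ((1 - _) ^+ m) => U V; rewrite /y.
move: (m.+1%:R : R) ('C(n, b)%:R : R) cr C0 => c C cr C0.
by field; rewrite cr n0 X0 Y0 C0.
Qed.

(** * Comparison of the integral with 1 on both sides of the threshold *)

Lemma binom_below_mean_decr (R : realType) (b n : nat) :
  (0 < b)%N -> (b < n)%N -> (n <= 3 * b + 1)%N ->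
  binom_below_mean R (b + 1) n < binom_below_mean R b n.
Proof.
move=> b0 bn n_le; have [K [q [K0 E dq]]] := binom_below_mean_step R b0 bn.
rewrite -subr_lt0 E pmulr_rlt0// -ltrBrDl sub0r.
set D : R := 2 * b%:R + 1.
have D0 : 0 < D by rewrite ltr_wpDl// mulr_ge0 ?ler0n.
have bE : b%:R = (D - 1) / 2 by rewrite /D; field.
(* Coefficients of minus the lower bound, since the derivative of [q] is minus the integrand. *)
apply: le_lt_trans (horner_increment_le_quartic (a0 := -1) (a1 := - D^-1)
  (a2 := (3 * b%:R + 2) / D ^+ 2) (a3 := - (D ^+ 2)^-1) (a4 := 0) _) _.
  move=> s s01; rewrite dq lerNl.
  (* The threshold n <= 3b+1 enters here. *)
  have le2b : ((n - b).-1 <= 2 * b)%N by lia.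
  apply: le_trans (density_ratio_anti b s01 le2b).
  apply: le_trans (density_ratio_lower b0 s01); rewrite -/D le_eqVlt.
  by apply/orP; left; apply/eqP; field; lra.
rewrite -subr_gt0.
have -> : -1 - (-1 + - D^-1 / 2 + (3 * b%:R + 2) / D ^+ 2 / 3
    + - (D ^+ 2)^-1 / 4 + 0 / 5) = (12 * D ^+ 2)^-1.
  by rewrite bE; field; lra.
by rewrite invr_gt0 mulr_gt0 ?exprn_gt0.
Qed.

Lemma binom_below_mean_incr (R : realType) (b n : nat) :
  (0 < b)%N -> (3 * b + 2 <= n)%N ->
  binom_below_mean R b n < binom_below_mean R (b + 1) n.
Proof.
move=> b0 n_ge; have bn : (b < n)%N by lia.
have [K [q [K0 E dq]]] := binom_below_mean_step R b0 bn.
rewrite -subr_gt0 E pmulr_rgt0// -[q.[1] - _]opprK subr_gt0.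
have -> : - (q.[1] - q.[0]) = (- q).[1] - (- q).[0].
  by rewrite !hornerN opprB opprK addrC.
set c : R := b%:R + 1.
have c2 : 2 <= c by rewrite /c -lerBlDr (_ : 2 - 1 = 1) ?ler1n//; ring.
(* The upper bound, with [x] substituted, expanded in powers of [s]. *)
apply: le_lt_trans (horner_increment_le_quartic (a0 := 1) (a1 := (2 * c)^-1)
  (a2 := (6 / 5 - (3 * c + 1) / 4 - 1 / 2) / c ^+ 2)
  (a3 := 1 / (4 * c ^+ 2) + (3 * c + 1) / (8 * c ^+ 3) - 9 / (5 * c ^+ 2))
  (a4 := 27 / (40 * c ^+ 2) - 1 / (8 * c ^+ 3)) _) _.
  move=> s s01; rewrite derivN hornerN dq opprK.
  have ge2b : ((2 * b).+1 <= (n - b).-1)%N by lia.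
  apply: le_trans (density_ratio_anti b s01 ge2b) _.
  apply: le_trans (density_ratio_upper b0 s01 (erefl c) erefl) _.
  by rewrite le_eqVlt; apply/orP; left; apply/eqP; field; lra.
rewrite -subr_gt0.
set gap := (X in 0 < X).
have -> : gap = (7 * c - 5) / (800 * c ^+ 3) by rewrite /gap; field; lra.
have c0 : 0 < c by lra.
rewrite divr_gt0 ?mulr_gt0 ?exprn_gt0 ?ltr0n//.
by rewrite subr_gt0; clear -c2; lra.
Qed.

Theorem theorem3 (R : realType) (b n : nat) (b_gt0 : (0 < b)%N)
    (bn : (b + 1 <= n)%N) :
  ((3 * b + 2 <= n)%N ->
     binom_below_mean R b n < binom_below_mean R (b + 1)%N n) /\
  ((n <= 3 * b + 1)%N ->
     binom_below_mean R (b + 1)%N n < binom_below_mean R b n).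
Proof.
rewrite addn1 in bn; split.
  exact: binom_below_mean_incr.
exact: binom_below_mean_decr.
Qed.
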